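(* The matrices $U_n$ satisfy the following recursion: $U_0=(1)$ and, for every integer $n\ge 0$, $U_{n+1}=(U_n\oplus 1)\,F_{U_n}$, where $$F_{U_n}=\begin{pmatrix} I_{n+1} & -U_{n+1}^{-1}[i,n+1]_{0\le i\le n}\\ \mathbf{0}_{n+1}^{\intercal} & 1\end{pmatrix}.$$
   Context: Let $t_{a,b}$ be real scalars for integers $0\le a<b$ (one fixed family, used for all $n$). Rows and columns of $(n+1)\times(n+1)$ matrices are indexed by $0,\dots,n$. For an integer $n\ge 0$, let $\mathcal{P}^{U_n}_{i,j}$ be the set of sequences of points $(k,y_k)$, $k=0,\dots,n$, with $y_k\in\{0,\dots,n\}$, $y_0=i$, $y_n=j$, $y_{k+1}\in\{y_k,y_k+1\}$ for $k<n$, and such that $y_{k+1}=y_k+1$ implies $y_k\ge k$. A rise step from $(k,y)$ to $(k+1,y+1)$ (with $y\neq n$) has weight $t_{y-k,y+1}$, and a horizontal step from $(k,y)$ to $(k+1,y)$ has weight $1$; the weight $\omega(p)$ of $p\in\mathcal{P}^{U_n}_{i,j}$ is the product of the weights of its steps. $U_n$ is the $(n+1)\times(n+1)$ matrix with $U_n[i,j]=\sum_{p\in\mathcal{P}^{U_n}_{i,j}}\omega(p)$; it is unit upper triangular, hence invertible, and $U_n^{-1}$ denotes its inverse. $I_n$ is the $n\times n$ identity matrix, $\mathbf{0}_n$ is the column vector of $n$ zeros, $U_n\oplus 1$ is the block diagonal matrix with diagonal blocks $U_n$ and $(1)$, and $U_{n+1}^{-1}[i,n+1]_{0\le i\le n}$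 is the column vector of the first $n+1$ entries of the last column of $U_{n+1}^{-1}$. *)

(* Defs.v *)
From mathcomp Require Import all_boot all_order all_algebra.
From mathcomp Require Import reals.

Set Implicit Arguments.
Unset Strict Implicit.
Unset Printing Implicit Defensive.

Import GRing.Theory.
Local Open Scope ring_scope.

(* A path is given by its sequence of heights y_0, ..., y_n.  For k : 'I_n,
   [left_end k] and [right_end k] are k and k + 1 as elements of 'I_n.+1. *)
Definition left_end (n : nat) (k : 'I_n) : 'I_n.+1 := widen_ord (leqnSn n) k.
Definition right_end (n : nat) (k : 'I_n) : 'I_n.+1 := lift ord0 k.

Definition rises (n : nat) (y : {ffun 'I_n.+1 -> 'I_n.+1}) (k : 'I_n) : bool :=
  y (right_end k) == (y (left_end k)).+1 :> nat.

Definition stays (n : nat) (y : {ffun 'I_n.+1 -> 'I_n.+1}) (k : 'I_n) : bool :=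
  y (right_end k) == y (left_end k).

Definition paths (n : nat) (i j : 'I_n.+1) : {set {ffun 'I_n.+1 -> 'I_n.+1}} :=
  [set y : {ffun 'I_n.+1 -> 'I_n.+1} |
    [&& y ord0 == i, y ord_max == j,
        [forall k : 'I_n, stays y k || rises y k] &
        [forall k : 'I_n, rises y k ==> (k <= y (left_end k))%N]]].

(* [t a b] is relevant only for a < b.  On a path in [paths], a rise at k has
   k <= y_k, so the subtraction below is not truncated and y_k - k < y_k + 1. *)
Definition step_weight (R : realType) (t : nat -> nat -> R) (n : nat)
    (y : {ffun 'I_n.+1 -> 'I_n.+1}) (k : 'I_n) : R :=
  if rises y k then t (y (left_end k) - k)%N (y (left_end k)).+1 else 1.

Definition path_weight (R : realType) (t : nat -> nat -> R) (n : nat)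
    (y : {ffun 'I_n.+1 -> 'I_n.+1}) : R :=
  \prod_(k < n) step_weight t y k.

Definition U (R : realType) (t : nat -> nat -> R) (n : nat) : 'M[R]_n.+1 :=
  \matrix_(i, j) \sum_(y in paths i j) path_weight t y.

(* The casts identify 'M_(n.+1 + 1) with 'M_n.+2. *)
Definition oplus1 (R : realType) (n : nat) (A : 'M[R]_n.+1) : 'M[R]_n.+2 :=
  castmx (addn1 n.+1, addn1 n.+1) (block_mx A 0 0 (1%:M : 'M[R]_1)).

Definition inv_last_col (R : realType) (t : nat -> nat -> R) (n : nat) :
    'cV[R]_n.+1 :=
  \col_(i < n.+1) invmx (U t n.+1) (widen_ord (leqnSn n.+1) i) ord_max.

Definition FU (R : realType) (t : nat -> nat -> R) (n : nat) : 'M[R]_n.+2 :=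
  castmx (addn1 n.+1, addn1 n.+1)
    (block_mx (1%:M : 'M[R]_n.+1) (- inv_last_col t n)
              0                   (1%:M : 'M[R]_1)).

Lemma paths_homo (n : nat) (i j : 'I_n.+1) (y : {ffun 'I_n.+1 -> 'I_n.+1}) :
  y \in paths i j -> {homo y : k l / (k <= l)%N}.
Proof.
rewrite inE => /and4P[_ _ /forallP Hs _] k l.
have step (m : nat) : (m < n)%N -> (y (inord m) <= y (inord m.+1))%N.
  move=> mn; have := Hs (Ordinal mn); rewrite /stays /rises.
  have -> : left_end (Ordinal mn) = inord m.
    by apply: val_inj; rewrite /= inordK // ltnS ltnW.
  have -> : right_end (Ordinal mn) = inord m.+1.
    by apply: val_inj; rewrite /= inordK.
  by case/orP=> /eqP ->.
rewrite -{2}[k]inord_val -{2}[l]inord_val.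
have := ltn_ord l; move: (val l) => {}l; move: (val k) => {}k.
elim: l => [|l IHl] ln; first by rewrite leqn0 => /eqP ->.
rewrite leq_eqVlt => /predU1P[-> //|]; rewrite ltnS => kl.
exact: leq_trans (IHl (ltnW ln) kl) (step _ ln).
Qed.

Lemma U_lower (R : realType) (t : nat -> nat -> R) (n : nat) (i j : 'I_n.+1) :
  (j < i)%N -> U t n i j = 0.
Proof.
move=> ji; rewrite mxE big1 // => y yP; exfalso.
have := paths_homo yP (leq0n (ord_max : 'I_n.+1) : (ord0 : 'I_n.+1) <= _)%N.
by move: yP; rewrite inE => /and4P[/eqP -> /eqP -> _ _]; rewrite leqNgt ji.
Qed.

Lemma U_diag (R : realType) (t : nat -> nat -> R) (n : nat) (i : 'I_n.+1) :
  U t n i i = 1.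
Proof.
have cP : [ffun=> i] \in paths i i.
  rewrite in_set !ffunE eqxx /=; apply/andP; split; apply/forallP => k.
    by rewrite /stays !ffunE eqxx.
  by rewrite /rises !ffunE (ltn_eqF (ltnSn _)).
rewrite mxE (bigD1 _ cP) /= [X in _ + X]big1 ?addr0 => [|y /andP[yP]].
  rewrite /path_weight big1 // => k _.
  by rewrite /step_weight /rises !ffunE (ltn_eqF (ltnSn _)).
case/eqP; apply/ffunP => k; rewrite ffunE; apply/val_inj/eqP.
have h0 := paths_homo yP (leq0n k : (ord0 : 'I_n.+1) <= k)%N.
have h1 := paths_homo yP (leq_ord k : k <= (ord_max : 'I_n.+1))%N.
have : y \in paths i i := yP; rewrite inE => /and4P[/eqP y0 /eqP yn _ _].
by move: h0 h1; rewrite y0 yn eqn_leq => -> ->.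
Qed.

Lemma U_unit (R : realType) (t : nat -> nat -> R) (n : nat) : U t n \in unitmx.
Proof.
rewrite -unitmx_tr unitmxE det_trig.
  by rewrite big1 ?unitr1 // => i _; rewrite mxE U_diag.
by apply/is_trig_mxP => i j ij; rewrite mxE U_lower.
Qed.

(* Main.v *)
Require Import Defs.
From mathcomp Require Import all_boot all_order all_algebra.
From mathcomp Require Import reals.

Set Implicit Arguments.
Unset Strict Implicit.
Unset Printing Implicit Defensive.

Local Open Scope ring_scope.

(** The recursion holds because the matrices [U t n] are nested: [U t n] is the
    upper left block of [U t n.+1].  A path of [paths] on [n.+1] steps that ends
    at a height at most [n] cannot rise on its last step, since a rise out of
    abscissa [n] starts at height at least [n] and so ends at height [n.+1].
    The last step is thus horizontal, of weight [1], and deleting it is a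
    weight-preserving bijection onto the paths on [n] steps with the same
    endpoints ([U_widen]).

    Unitriangularity then gives the block form with rows [U t n, c] and [0, 1]
    of [U t n.+1].  Its inverse has last column [v, 1] with [U t n * v + c = 0]
    ([U_last_col]), so that [c = U t n * (- v)], and this is the upper right
    block of the product of [oplus1 (U t n)] and [FU t n]. *)

Import GRing.Theory.

Local Notation widen := (widen_ord (leqnSn _)).

Lemma widen_inj (n : nat) : injective (fun i : 'I_n => widen i).
Proof. by move=> i j /(congr1 val) /= ij; apply: val_inj. Qed.

Lemma left_end_widen (n : nat) (k : 'I_n) : left_end (widen k) = widen (left_end k).
Proof. exact: val_inj. Qed.

Lemma right_end_widen (n : nat) (k : 'I_n) :
  right_end (widen k) = widen (right_end k).
Proof. exact: val_inj. Qed.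

Lemma right_end_max (n : nat) : right_end (ord_max : 'I_n.+1) = ord_max.
Proof. exact: val_inj. Qed.

Lemma forall_ord_recr (n : nat) (P : pred 'I_n.+1) :
  [forall k, P k] = [forall k : 'I_n, P (widen k)] && P ord_max.
Proof.
apply/forallP/andP => [Pall|[/forallP Pw Pm] k]; first by split=> //; apply/forallP.
have [-> //|km] := eqVneq k ord_max.
have kn : (k < n)%N by rewrite ltn_neqAle km -ltnS ltn_ord.
by rewrite (_ : k = widen (Ordinal kn)) //; apply: val_inj.
Qed.

(** Capping the abscissa at [n] repeats the last height, so the added step is
    horizontal. *)
Definition prolong (n : nat) (y : {ffun 'I_n.+1 -> 'I_n.+1}) :
    {ffun 'I_n.+2 -> 'I_n.+2} :=
  [ffun k : 'I_n.+2 => widen (y (inord (minn k n)))].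

(** The left inverse of [prolong]; heights that do not fit in ['I_n.+1] are sent
    to a junk value, which does not occur on the paths that end below the top
    ([truncateK]). *)
Definition truncate (n : nat) (z : {ffun 'I_n.+2 -> 'I_n.+2}) :
    {ffun 'I_n.+1 -> 'I_n.+1} :=
  [ffun k : 'I_n.+1 => inord (z (widen k))].

Lemma prolong_widen (n : nat) (y : {ffun 'I_n.+1 -> 'I_n.+1}) (k : 'I_n.+1) :
  prolong y (widen k) = widen (y k).
Proof. by rewrite ffunE /= (minn_idPl (leq_ord k)) inord_val. Qed.

Lemma prolong_max (n : nat) (y : {ffun 'I_n.+1 -> 'I_n.+1}) :
  prolong y ord_max = widen (y ord_max).
Proof.
rewrite ffunE /= (minn_idPr (leqnSn n)); congr (widen (y _)).
by apply: val_inj; rewrite /= inordK.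
Qed.

Lemma prolongK (n : nat) : cancel (@prolong n) (@truncate n).
Proof.
by move=> y; apply/ffunP => k; rewrite ffunE prolong_widen /= inord_val.
Qed.

Lemma rises_prolong (n : nat) (y : {ffun 'I_n.+1 -> 'I_n.+1}) (k : 'I_n) :
  rises (prolong y) (widen k) = rises y k.
Proof. by rewrite /rises left_end_widen right_end_widen !prolong_widen. Qed.

Lemma stays_prolong (n : nat) (y : {ffun 'I_n.+1 -> 'I_n.+1}) (k : 'I_n) :
  stays (prolong y) (widen k) = stays y k.
Proof. by rewrite /stays left_end_widen right_end_widen !prolong_widen. Qed.

Lemma stays_prolong_max (n : nat) (y : {ffun 'I_n.+1 -> 'I_n.+1}) :
  stays (prolong y) ord_max.
Proof. by rewrite /stays right_end_max prolong_max prolong_widen. Qed.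

Lemma rises_prolong_max (n : nat) (y : {ffun 'I_n.+1 -> 'I_n.+1}) :
  rises (prolong y) ord_max = false.
Proof.
by rewrite /rises right_end_max prolong_max prolong_widen (ltn_eqF (ltnSn _)).
Qed.

Lemma mem_prolong (n : nat) (i j : 'I_n.+1) (y : {ffun 'I_n.+1 -> 'I_n.+1}) :
  (prolong y \in paths (widen i) (widen j)) = (y \in paths i j).
Proof.
rewrite !inE prolong_max !(inj_eq (@widen_inj _)).
have -> : ord0 = widen (ord0 : 'I_n.+1) by apply: val_inj.
rewrite prolong_widen (inj_eq (@widen_inj _)).
rewrite !(forall_ord_recr (n := n)) stays_prolong_max rises_prolong_max !andbT.
congr [&& _, _, _ & _]; apply: eq_forallb => k.
  by rewrite stays_prolong rises_prolong.
by rewrite rises_prolong left_end_widen prolong_widen.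
Qed.

Lemma path_weight_prolong (R : realType) (t : nat -> nat -> R) (n : nat)
    (y : {ffun 'I_n.+1 -> 'I_n.+1}) :
  path_weight t (prolong y) = path_weight t y.
Proof.
rewrite /path_weight big_ord_recr /= /step_weight rises_prolong_max mulr1.
by apply: eq_bigr => k _; rewrite rises_prolong left_end_widen prolong_widen.
Qed.

(** A rise on the last step would start at a height at least [n], hence end above
    every [widen j]. *)
Lemma last_step_stays (n : nat) (i j : 'I_n.+1) (z : {ffun 'I_n.+2 -> 'I_n.+2}) :
  z \in paths (widen i) (widen j) -> z ord_max = z (widen ord_max).
Proof.
rewrite inE => /and4P[_ /eqP zj /forallP/(_ ord_max) zs /forallP/(_ ord_max) zr].
move: zs zr; rewrite /stays /rises right_end_max => /orP[/eqP //|/[dup] + ->].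
rewrite implyTb zj /= => /eqP jz; rewrite leqNgt => /negP[].
by have := leq_ord j; rewrite jz.
Qed.

Lemma truncateK (n : nat) (i j : 'I_n.+1) (z : {ffun 'I_n.+2 -> 'I_n.+2}) :
  z \in paths (widen i) (widen j) -> prolong (truncate z) = z.
Proof.
move=> zP.
have z_lt k : (z k < n.+1)%N.
  apply: leq_ltn_trans (paths_homo zP (leq_ord k : k <= @ord_max n.+1)%N) _.
  by move: zP; rewrite inE => /and4P[_ /eqP -> _ _] /=.
have zT k : widen (truncate z k) = z (widen k).
  by apply: val_inj; rewrite /= ffunE inordK.
apply/ffunP => k; have [kn|] := ltnP k n.+1.
  have -> : k = widen (Ordinal kn) by apply: val_inj.
  by rewrite prolong_widen zT.
move=> nk; have -> : k = ord_max by apply/val_inj/eqP; rewrite eqn_leq nk leq_ord.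
by rewrite prolong_max zT (last_step_stays zP).
Qed.

Lemma U_widen (R : realType) (t : nat -> nat -> R) (n : nat) (i j : 'I_n.+1) :
  U t n.+1 (widen i) (widen j) = U t n i j.
Proof.
rewrite !mxE (reindex_onto (@prolong n) (@truncate n)) => [|z]; last exact: truncateK.
apply: eq_big => [y|y _]; last exact: path_weight_prolong.
by rewrite mem_prolong prolongK eqxx andbT.
Qed.

Lemma invmx_U_max (R : realType) (t : nat -> nat -> R) (n : nat) :
  invmx (U t n.+1) ord_max ord_max = 1.
Proof.
have /matrixP/(_ ord_max ord_max) := mulmxV (U_unit t n.+1).
rewrite [LHS]mxE [RHS]mxE eqxx big_ord_recr /= big1 => [|k _]; last by rewrite U_lower ?mul0r ?(ltn_ord k).
by rewrite add0r U_diag mul1r.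
Qed.

(** Row [i] of the last column of [U t n.+1 *m invmx (U t n.+1) = 1], with the
    bottom entry of that column of the inverse equal to [1]. *)
Lemma U_last_col (R : realType) (t : nat -> nat -> R) (n : nat) (i : 'I_n.+1) :
  U t n.+1 (widen i) ord_max = (U t n *m - inv_last_col t n) i 0.
Proof.
have /matrixP/(_ (widen i) ord_max) := mulmxV (U_unit t n.+1).
rewrite [LHS]mxE [RHS]mxE -val_eqE /= (ltn_eqF (ltn_ord i)) big_ord_recr /=.
rewrite invmx_U_max mulr1 => /eqP; rewrite addrC addr_eq0 => /eqP ->.
rewrite mulmxN [RHS]mxE [in RHS]mxE; congr (- _).
by apply: eq_bigr => k _; rewrite U_widen [inv_last_col _ _ _ _]mxE.
Qed.

Lemma mulmx_cast_square (R : pzSemiRingType) (m n : nat) (e : m = n) (A B : 'M[R]_m) :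
  castmx (e, e) A *m castmx (e, e) B = castmx (e, e) (A *m B).
Proof. by case: n / e. Qed.

Theorem proposition3p2 (R : realType) (t : nat -> nat -> R) :
  U t 0 = 1%:M /\
  forall n : nat, U t n.+1 = oplus1 (U t n) *m FU t n.
Proof.
split=> [|n]; first by apply/matrixP => i j; rewrite !ord1 U_diag mxE.
rewrite /oplus1 /FU mulmx_cast_square mulmx_block.
rewrite !mulmx1 !mulmx0 !mul0mx !addr0 !add0r.
have cast_l (k : 'I_n.+1) : cast_ord (addn1 n.+1) (lshift 1 k) = widen k.
  exact: val_inj.
have cast_r (k : 'I_1) : cast_ord (addn1 n.+1) (rshift n.+1 k) = ord_max.
  by apply: val_inj; rewrite /= ord1 addn0.
apply/matrixP => i j; rewrite castmxE /=.
rewrite -[in LHS](cast_ordKV (addn1 n.+1) i) -[in LHS](cast_ordKV (addn1 n.+1) j).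
move: (cast_ord _ i) (cast_ord _ j) => {}i {}j.
case: (@split_ordP n.+1 1 i) => i' ->; case: (@split_ordP n.+1 1 j) => j' ->.
- by rewrite block_mxEul !cast_l U_widen.
- by rewrite block_mxEur cast_l cast_r U_last_col ord1.
- by rewrite block_mxEdl cast_l cast_r [RHS]mxE U_lower // (ltn_ord j').
- by rewrite block_mxEdr !cast_r U_diag !ord1 mxE.
Qed.
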